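(* Let $L$ be a complete and completely distributive lattice and let $f:G\to H$ be a surjective group homomorphism. Let $\mu\in L(G)$ be such that $\mu$ possesses the sup-property. If $\eta$ is a pronormal $L$-subgroup of $\mu$, then $f(\eta)$ is a pronormal $L$-subgroup of $f(\mu)$.
   Context: $L$ has least element $0$ and greatest element $1$. For a group $G$, an $L$-subset of $G$ is a function $G \to L$; inclusion $\eta\subseteq\mu$ means $\eta(x)\le\mu(x)$ for all $x\in G$; unions and intersections of $L$-subsets are pointwise joins and meets. An $L$-subgroup of $G$ is a function $\mu: G\to L$ with $\mu(xy)\ge\mu(x)\wedge\mu(y)$ and $\mu(x^{-1})=\mu(x)$ for all $x,y\in G$; $L(G)$ is the set of these. For $\mu\in L(G)$, $L(\mu)$ denotes the set of $\eta\in L(G)$ with $\eta\subseteq\mu$ (the $L$-subgroups of $\mu$). For an $L$-subset $\theta$ of $G$, $\langle\theta\rangle$ is the smallest $L$-subgroup of $G$ containing $\theta$, and $\langle\eta,\nu\rangle=\langle\eta\cup\nu\rangle$. Image: for $f:G\to H$ and an $L$-subset $\mu$ of $G$, $f(\mu)(y)=\bigvee_{x\in f^{-1}(y)}\mu(x)$ for $y\in H$. Sup-property: $\mu:G\to L$ possesses the sup-property if for each non-empty $A\subseteq G$ there exists $a_0\in A$ with $\bigvee_{a\in A}\mu(a)=\mu(a_0)$. $L$-points: for $a\in L$, $x\in G$, the $L$-point $a_x$ is the $L$-subset with value $a$ at $x$ and $0$ elsewhere; $a_x\in\mu$ means $\mu(x)\ge a$. Conjugate: for $\eta\in L(\mu)$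 and $a_z\in\mu$, $\eta^{a_z}$ is the $L$-subgroup of $\mu$ given by $\eta^{a_z}(x)=a\wedge\eta(zxz^{-1})$ for all $x\in G$. Pronormal: $\eta\in L(\mu)$ is a pronormal $L$-subgroup of $\mu$ if for every $L$-point $a_x\in\mu$ there exists an $L$-point $b_y\in\langle\eta,\eta^{a_x}\rangle$ such that $\eta^{b_y}=\eta^{a_x}$. (All of these notions apply equally to $L$-subgroups of $H$.) *)

(* Defs.v *)
From HB Require Import structures.
From mathcomp Require Import all_boot all_order.
From mathcomp Require Import boolp classical_sets functions.

Set Implicit Arguments.
Unset Strict Implicit.
Unset Printing Implicit Defensive.

Import Order.TTheory.
Local Open Scope classical_set_scope.

Section CompleteLattices.
Context {d : Order.disp_t} {L : tbLatticeType d}.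
Implicit Types A : set L.

(* The library's [supremum] and [infimum] take a default value, returned on
   the empty set and on sets without bound; the defaults below make [lsup set0]
   and [linf set0] the genuine supremum and infimum of the empty set. *)
Definition lsup A : L := supremum \bot%O A.
Definition linf A : L := infimum \top%O A.

End CompleteLattices.

Definition complete_lattice d (L : tbLatticeType d) : Prop :=
  forall A : set L, supremums A !=set0 /\ infimums A !=set0.

(* The supremum on the right ranges over the choice functions of the family J. *)
Definition completely_distributive d (L : tbLatticeType d) : Prop :=
  forall (I : Type) (J : I -> set L),
    linf [set lsup (J i) | i in [set: I]] =
    lsup [set linf [set phi i | i in [set: I]] |
           phi in [set phi : I -> L | forall i, J i (phi i)]].

Section CompleteLatticeTheory.
Context {d : Order.disp_t} {L : tbLatticeType d}.
Hypothesis compL : complete_lattice L.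
Implicit Types A : set L.

Lemma lsup_supremums A : supremums A (lsup A).
Proof.
rewrite /lsup /supremum; case: eqP => [->|_].
  by split=> [x []|x _]; exact: le0x.
have [[m Am] _] := compL A.
by case: xgetP => [y _ //|/(_ m)].
Qed.

Lemma linf_infimums A : infimums A (linf A).
Proof.
rewrite /linf /infimum; case: eqP => [->|_].
  by split=> [x []|x _]; exact: lex1.
have [_ [m Am]] := compL A.
by case: xgetP => [y _ //|/(_ m)].
Qed.

End CompleteLatticeTheory.

Section LSubsets.
Context {d : Order.disp_t} {L : tbLatticeType d} {G : groupType}.
Implicit Types (eta nu mu theta : G -> L) (a : L) (x z : G).

Definition lsubset eta mu : Prop := forall x, (eta x <= mu x)%O.

Definition lunion eta nu : G -> L := fun x => (eta x `|` nu x)%O.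

Definition lsubgroup mu : Prop :=
  (forall x y, (mu x `&` mu y <= mu (x * y)%g)%O) /\
  (forall x, mu (x^-1)%g = mu x).

(* eta \in L(mu), which presupposes mu \in L(G). *)
Definition lsubgroup_of mu eta : Prop :=
  [/\ lsubgroup mu, lsubgroup eta & lsubset eta mu].

(* The smallest L-subgroup containing theta, as the intersection of all of
   them; see [lgen_lsubgroup], [lsubset_lgen] and [lgen_min]. *)
Definition lgen theta : G -> L := fun x =>
  linf [set nu x | nu in [set nu | lsubgroup nu /\ lsubset theta nu]].

Definition sup_property mu : Prop :=
  forall A : set G, A !=set0 -> exists2 a0, A a0 & lsup (mu @` A) = mu a0.

(* The L-point a_x. The notions below that depend on an L-point take the pair
   (a, x): for a = \bot all pairs give the same L-point, and the same values of
   these notions. *)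
Definition lpoint a x : G -> L := fun y => if y == x then a else \bot%O.

Definition lpoint_in a x mu : Prop := (a <= mu x)%O.

Definition lconj eta a z : G -> L := fun x => (a `&` eta (z * x * z^-1)%g)%O.

Definition pronormal mu eta : Prop :=
  lsubgroup_of mu eta /\
  forall a x, lpoint_in a x mu ->
    exists b y, lpoint_in b y (lgen (lunion eta (lconj eta a x))) /\
                lconj eta b y = lconj eta a x.

Lemma lpoint_inE a x mu : lpoint_in a x mu <-> lsubset (lpoint a x) mu.
Proof.
split=> [h y|/(_ x)]; rewrite /lpoint ?eqxx //.
by case: eqP => [->|_]; [exact: h|exact: le0x].
Qed.

Lemma lconj_lsubgroup_of mu eta a z :
  lsubgroup_of mu eta -> lpoint_in a z mu -> lsubgroup_of mu (lconj eta a z).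
Proof.
move=> [[muM muV] [etaM etaV] em] az; split=> //.
- split=> [x y|x]; rewrite /lconj.
    rewrite meetACA meetxx leI2 //.
    have -> : (z * (x * y) * z^-1 = (z * x * z^-1) * (z * y * z^-1))%g.
      by rewrite !mulgA mulgVK.
    exact: etaM.
  by congr Order.meet; rewrite -etaV !invgM !invgK mulgA.
- move=> x; rewrite /lconj.
  have -> : mu x = mu (z^-1 * (z * x * z^-1) * z)%g.
    by rewrite !mulgA mulVg mul1g mulgVK.
  apply: le_trans (muM _ _); rewrite lexI; apply/andP; split; last first.
    by apply: leIxl; exact: az.
  by apply: le_trans (muM _ _); rewrite muV; apply: leI2; [exact: az|exact: em].
Qed.

Hypothesis compL : complete_lattice L.

Lemma lsubset_lgen theta : lsubset theta (lgen theta).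
Proof.
move=> x; apply: (linf_infimums compL _).2 => _ [nu [_ tn] <-].
exact: tn.
Qed.

Lemma lgen_min theta nu :
  lsubgroup nu -> lsubset theta nu -> lsubset (lgen theta) nu.
Proof.
by move=> nuG tn x; apply: (linf_infimums compL _).1; exists nu.
Qed.

Lemma lgen_lsubgroup theta : lsubgroup (lgen theta).
Proof.
split=> [x y|x].
  apply: (linf_infimums compL _).2 => _ [nu [nuG tn] <-].
  by apply: le_trans (nuG.1 x y); apply: leI2; exact: lgen_min.
by congr linf; apply: eq_imagel => nu [[_ nuV] _]; exact: nuV.
Qed.

End LSubsets.

Definition limage {d : Order.disp_t} {L : tbLatticeType d} {G H : groupType}
    (f : G -> H) (mu : G -> L) : H -> L :=
  fun y => lsup (mu @` (f @^-1` [set y])).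

(* Main.v *)
Require Import Defs.
From HB Require Import structures.
From mathcomp Require Import all_boot all_order.
From mathcomp Require Import boolp classical_sets functions.

(** Complete distributivity gives the frame law, so taking images commutes with
    conjugation: [f(eta^(a_x)) = f(eta)^(a_(f x))].  The sup-property lifts an
    L-point [a_y] of [f(mu)] to an L-point [a_x] of [mu] with [f x = y].
    Pronormality of [eta] then yields [b_z] with [eta^(b_z) = eta^(a_x)], and
    [b_(f z)] works for [f(eta)], since the preimage under [f] of the
    L-subgroup generated by [f(eta)] and [f(eta)^(a_y)] is an L-subgroup
    containing [eta] and [eta^(a_x)]. *)

Import Order.TTheory.
Local Open Scope classical_set_scope.

Section CompletelyDistributive.
Context {d : Order.disp_t} {L : tbLatticeType d}.
Hypothesis compL : complete_lattice L.
Implicit Types (A B : set L) (a c : L).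

Lemma le_lsup A a : A a -> (a <= lsup A)%O.
Proof. exact: (lsup_supremums compL A).1. Qed.

Lemma lsup_le A c : (forall a, A a -> (a <= c)%O) -> (lsup A <= c)%O.
Proof. exact: (lsup_supremums compL A).2. Qed.

Lemma linf_le A a : A a -> (linf A <= a)%O.
Proof. exact: (linf_infimums compL A).1. Qed.

Lemma le_linf A c : (forall a, A a -> (c <= a)%O) -> (c <= linf A)%O.
Proof. exact: (linf_infimums compL A).2. Qed.

Hypothesis distrL : completely_distributive L.

(** Complete distributivity for a family of two sets, indexed by [bool]: a choice function [phi]
    amounts to a pair in [A] and [B], and its infimum lies below the meet of that pair. *)
Lemma lsupI_le A B c :
  (forall a b, A a -> B b -> (a `&` b <= c)%O) ->
  (lsup A `&` lsup B <= c)%O.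
Proof.
move=> ABc; pose J (i : bool) := if i then A else B.
have := distrL _ J; set inf_sup := linf _ => infE.
apply: (@le_trans _ _ inf_sup).
  by apply: le_linf => _ [[] _ <-]; [exact: leIl|exact: leIr].
rewrite infE; apply: lsup_le => _ [phi Jphi <-].
apply: le_trans (ABc _ _ (Jphi true) (Jphi false)).
by rewrite lexI !linf_le.
Qed.

Lemma meet_lsup_le a B c :
  (forall b, B b -> (a `&` b <= c)%O) -> (a `&` lsup B <= c)%O.
Proof.
(* Viewing [a] as a bound of its own singleton turns this into a meet of two suprema. *)
move=> Bc; apply: (@le_trans _ _ (lsup [set a] `&` lsup B)%O).
  by rewrite leI2 // le_lsup.
by apply: lsupI_le => _ b ->; exact: Bc.
Qed.

End CompletelyDistributive.

(* The library states [gmulfV] for magma morphisms that preserve 1, which for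
   groups is automatic. *)
Lemma multiplicativeV (G H : groupType) (f : {multiplicative G -> H}) x :
  (f x^-1 = (f x)^-1)%g.
Proof.
have f1 : (f 1 = 1)%g by apply: (mulgI (f 1%g)); rewrite -gmulfM !mulg1.
by apply: (mulgI (f x)); rewrite -gmulfM !mulgV.
Qed.

Section Image.
Context {d : Order.disp_t} {L : tbLatticeType d}.
Hypothesis compL : complete_lattice L.
Context {G H : groupType} (f : {multiplicative G -> H}).
Implicit Types (eta mu : G -> L) (nu : H -> L).

Lemma le_limage eta x : (eta x <= limage f eta (f x))%O.
Proof. by apply: le_lsup => //; exists x. Qed.

(** The adjunction between image and preimage; it trades suprema over fibres for pointwise bounds on
    [G]. *)
Lemma limage_subset eta nu :
  lsubset (limage f eta) nu <-> lsubset eta (nu \o f).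
Proof.
split=> [sub x|sub y]; first exact: le_trans (le_limage _ _) (sub _).
by apply: lsup_le => // _ [x <- <-]; exact: sub.
Qed.

Lemma limageS eta mu :
  lsubset eta mu -> lsubset (limage f eta) (limage f mu).
Proof.
move=> sub; apply/limage_subset => x.
exact: le_trans (sub x) (le_limage _ _).
Qed.

Lemma lsubgroup_comp nu : lsubgroup nu -> lsubgroup (nu \o f).
Proof.
by case=> nuM nuV; split=> [x y|x] /=; rewrite (gmulfM, multiplicativeV).
Qed.

Lemma lsub_lgen_comp eta theta nu :
  lsubset eta (nu \o f) -> lsubset theta (nu \o f) -> lsubgroup nu ->
  lsubset (lgen (lunion eta theta)) (nu \o f).
Proof.
move=> sub1 sub2 nuG; apply: lgen_min => //; first exact: lsubgroup_comp.
by move=> x; rewrite leUx sub1 sub2.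
Qed.

Hypothesis distrL : completely_distributive L.

Lemma limage_lsubgroup eta : lsubgroup eta -> lsubgroup (limage f eta).
Proof.
case=> etaM etaV.
(* One inequality suffices: at [y^-1] it gives the converse. *)
have leV y : (limage f eta y <= limage f eta y^-1%g)%O.
  apply: lsup_le => // _ [x <- <-].
  by rewrite -etaV -multiplicativeV; exact: le_limage.
split=> [y z|y]; last by apply/eqP; rewrite eq_le leV andbT -{2}[y]invgK leV.
apply: lsupI_le => // _ _ [u <- <-] [v <- <-].
by rewrite -gmulfM; apply: le_trans (etaM u v) (le_limage _ _).
Qed.

Lemma limage_lsubgroup_of mu eta :
  lsubgroup_of mu eta -> lsubgroup_of (limage f mu) (limage f eta).
Proof.
by case=> muG etaG sub; split; [exact: limage_lsubgroup..|exact: limageS].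
Qed.

Lemma limage_lconj eta a x :
  limage f (lconj eta a x) = lconj (limage f eta) a (f x).
Proof.
apply/funext => y; apply/eqP; rewrite eq_le; apply/andP; split.
  apply: lsup_le => // _ [u <- <-].
  by rewrite /lconj leI2 // -multiplicativeV -!gmulfM le_limage.
apply: meet_lsup_le => // _ [u fu <-].
(* Here [u] lies over the conjugate of [y] by [f x], so conjugating back by [x] gives a point over
   [y]. *)
have -> : (a `&` eta u)%O = lconj eta a x (x^-1 * u * x)%g.
  by rewrite /lconj !mulgA mulgV mul1g mulgK.
have -> : y = f (x^-1 * u * x)%g.
  by rewrite !gmulfM multiplicativeV fu !mulgA mulVg mul1g mulgVK.
exact: le_limage.
Qed.

End Image.

Theorem theorem3p7 (d : Order.disp_t) (L : tbLatticeType d)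
    (L_complete : complete_lattice L)
    (L_distributive : completely_distributive L)
    (G H : groupType) (f : {multiplicative G -> H})
    (f_surj : set_surj [set: G] [set: H] f)
    (mu : G -> L) (mu_subgroup : lsubgroup mu) (mu_sup : sup_property mu)
    (eta : G -> L) (eta_pronormal : pronormal mu eta) :
  pronormal (limage f mu) (limage f eta).
Proof.
case: eta_pronormal => eta_mu pron.
split; first exact: limage_lsubgroup_of.
move=> a y ay.
(* Surjectivity makes the fibre of [y] non-empty, so the supremum over it is attained. *)
have [x fx mux] : exists2 x, f x = y & limage f mu y = mu x.
  apply: mu_sup; have [x _ fx] := f_surj y I.
  by exists x.
have ax : lpoint_in a x mu by rewrite /lpoint_in -mux.
have [b [z [bz conjE]]] := pron a x ax.
exists b, (f z); rewrite -fx -!limage_lconj // conjE; split=> //.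
(* It remains to compare the L-subgroup generated in [G], at [z], with the one generated in [H], at
   [f z]. *)
apply: (le_trans bz).
set theta := lunion (limage f eta) _.
have sub w : (limage f eta w `|` limage f (lconj eta a x) w <= lgen theta w)%O.
  exact: lsubset_lgen.
apply: (lsub_lgen_comp L_complete f _ _ (lgen theta)); last first.
- exact: lgen_lsubgroup.
- by apply/(limage_subset L_complete) => w; apply: le_trans (sub w); exact: leUr.
- by apply/(limage_subset L_complete) => w; apply: le_trans (sub w); exact: leUl.
Qed.
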